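(* Let $\mathcal M$ be a fixed-point model of $\mathrm{CSV}$, i.e. a structure such that for every world $w\in W_{\mathcal M}$, the set $X=\mathcal I_{\mathcal M}(w)$ satisfies $X=\mathcal J_{\mathrm{csv}}(X)$. Then $\mathcal M\vDash_{\mathrm G}A$ (every world of $\mathcal M$ globally forces $A$) for each of the following sentences $A$ (the axioms of $\mathrm{CSV}$): 1. $\forall s,t\,((\mathrm{Tr}(s\underset{\cdot}{=}t)\leftrightarrow s^\circ=t^\circ)\wedge(\mathrm{Tr}(s\underset{\cdot}{\ne}t)\leftrightarrow s^\circ\neq t^\circ))$; 2. $\forall x,y\,(\mathrm{Sent}(x\underset{\cdot}{\vee}y)\to(\mathrm{Tr}(x\underset{\cdot}{\vee}y)\leftrightarrow\mathrm{Tr}\,x\vee\mathrm{Tr}\,y))$; 3. $\forall x,y\,(\mathrm{Sent}(x\underset{\cdot}{\wedge}y)\to(\mathrm{Tr}(x\underset{\cdot}{\wedge}y)\leftrightarrow\mathrm{Tr}\,x\wedge\mathrm{Tr}\,y))$; 4. $\forall x,v\,(\mathrm{Sent}(\underset{\cdot}{\exists}vx)\to(\mathrm{Tr}(\underset{\cdot}{\exists}vx)\leftrightarrow\exists t\,\mathrm{Tr}\,x(t/v)))$; 5. $\forall x,v\,(\mathrm{Sent}(\underset{\cdot}{\forall}vx)\to(\mathrm{Tr}(\underset{\cdot}{\forall}vx)\leftrightarrow\forall t\,\mathrm{Tr}\,x(t/v)))$; 6. $\forall x,y\,(\mathrm{Sent}(x\underset{\cdot}{\to}y)\to(\mathrm{Tr}(x\underset{\cdot}{\to}y)\to(\mathrm{Tr}\,x\to\mathrm{Tr}\,y)))$;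 7. $\forall t\,(\mathrm{Tr}\,t^\circ\leftrightarrow\mathrm{Tr}\,\underset{\cdot}{\mathrm{Tr}}\,t)$; 8. $\forall x(\mathrm{Ax}_{\mathrm{HAT}}(x)\to\mathrm{Tr}\,x)$; 9. $\forall x(\mathrm{Tr}\,x\wedge\mathrm{Tr}\,\underset{\cdot}{\neg}x\to\bot)$; 10. $\forall x\,\mathrm{Tr}\ulcorner\mathrm{Tr}(\dot x)\to\mathrm{Sent}(\dot x)\urcorner$; 11. $\mathrm{Tr}\ulcorner\varphi\urcorner\to\varphi$, for every sentence $\varphi$ of $\mathcal L_{\mathrm{Tr}}$.
   Context: **Language.** $\mathcal L_{\mathbb N}$ is the language of Heyting arithmetic $\mathrm{HA}$ (logical symbols $\bot,\to,\vee,\wedge,\forall,\exists$; $\neg A$ is $A\to\bot$), with finitely many additional function symbols for primitive recursive functions. $\mathcal L_{\mathrm{Tr}}=\mathcal L_{\mathbb N}\cup\{\mathrm{Tr}\}$ with $\mathrm{Tr}$ a unary predicate. Fix a standard Gödel numbering; $\#\varphi$ is the code of $\varphi$, $\ulcorner\varphi\urcorner$ the numeral of the code, $\bar n$ the numeral of $n$, $t^{\mathbb N}$ the value of a closed term $t$ in the standard model. $\mathrm{SENT}\subseteq\omega$ is the set of codes of sentences of $\mathcal L_{\mathrm{Tr}}$; $\mathrm{Sent}(x)$ represents it. **Syntax notation.** Dotted symbols stand for the primitive recursive syntactic operations on codes (e.g. $x\underset{\cdot}{\vee}y$ is the code of the disjunction of the formulas coded by $x,y$; $\underset{\cdot}{\mathrm{Tr}}\,t$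 is the code of $\mathrm{Tr}(t)$ for the term coded by $t$); $x(t/v)$ is substitution; $\ulcorner\varphi(\dot x)\urcorner$ is the code of $\varphi$ with the numeral of $x$ substituted; $t^\circ$ is the value of the closed term coded by $t$; quantifiers over $s,t$ range over codes of closed terms. $\mathrm{HAT}$ is $\mathrm{HA}$ (Peano axioms over intuitionistic predicate logic with equality) formulated in $\mathcal L_{\mathrm{Tr}}$ with induction for all formulas of $\mathcal L_{\mathrm{Tr}}$; $\mathrm{Ax}_{\mathrm{HAT}}(x)$ represents ''$x$ is the code of a (closed) axiom of $\mathrm{HAT}$''. **Structures.** A *structure* (persistent first-order intuitionistic Kripke $\omega$-structure) is $\mathcal M=\langle W_{\mathcal M},\le_{\mathcal M},\mathcal D_{\mathcal M},\mathcal I_{\mathcal M}\rangle$ with $W_{\mathcal M}$ a set (of worlds), $\le_{\mathcal M}$ a partial order on it, $\mathcal D_{\mathcal M}$ assigning the domain $\omega$ to each world, and $\mathcal I_{\mathcal M}\subseteq W_{\mathcal M}\times\mathrm{SENT}$ such that $u\le_{\mathcal M}v$ and $\langle u,x\rangle\in\mathcal I_{\mathcal M}$ imply $\langle v,x\rangle\in\mathcal I_{\mathcal M}$. Write $\mathcal I_{\mathcal M}(w)=\{x:\langle w,x\rangle\in\mathcal I_{\mathcal M}\}$. **Global forcing** $w\Vdash_{\mathrm G,\mathcal M}A$ for sentences of $\mathcal L_{\mathrm{Tr}}$: $w\nVdash_{\mathrm G}\bot$; an atomic arithmetical sentence is forced iff true in $\mathbb N$; $w\Vdash_{\mathrm G}\mathrm{Tr}(s)$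 iff $s^{\mathbb N}\in\mathcal I_{\mathcal M}(w)$; $w\Vdash_{\mathrm G}A\wedge B$ iff $w\Vdash_{\mathrm G}A$ and $w\Vdash_{\mathrm G}B$; $w\Vdash_{\mathrm G}A\vee B$ iff ($w'\Vdash_{\mathrm G}A$ for all $w'\ge w$) or ($w'\Vdash_{\mathrm G}B$ for all $w'\ge w$); $w\Vdash_{\mathrm G}A\to B$ iff for all $w'\ge w$, $w'\Vdash_{\mathrm G}A$ implies $w'\Vdash_{\mathrm G}B$; $w\Vdash_{\mathrm G}\exists xA$ iff for all $w'\ge w$ there is $n\in\omega$ with $w'\Vdash_{\mathrm G}A(\bar n)$; $w\Vdash_{\mathrm G}\forall xA$ iff $w\Vdash_{\mathrm G}A(\bar n)$ for all $n\in\omega$. $\mathcal M\vDash_{\mathrm G}A$ iff $w\Vdash_{\mathrm G,\mathcal M}A$ for all $w\in W_{\mathcal M}$. **Embeddings.** $f:W_{\mathcal M}\to W_{\mathcal M'}$ is an embedding-interpretation function, written $\mathcal I_{\mathcal M}\leqq_f\mathcal I_{\mathcal M'}$, iff $f$ is injective, $w_0\le_{\mathcal M}w_1\Leftrightarrow f(w_0)\le_{\mathcal M'}f(w_1)$, and $\mathcal I_{\mathcal M}(w)\subseteq\mathcal I_{\mathcal M'}(f(w))$ for all $w$. **Compositional supervaluation** $w\Vdash^{\mathcal M}_{\mathrm{csv}}\varphi$ (sentences $\varphi$): for atomic $\varphi$ (including $\bot$), iff $w\Vdash_{\mathrm G,\mathcal M}\varphi$; $\psi\vee\chi$: iff ($w'\Vdash^{\mathcal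 M}_{\mathrm{csv}}\psi$ for all $w'\ge w$) or ($w'\Vdash^{\mathcal M}_{\mathrm{csv}}\chi$ for all $w'\ge w$); $\psi\wedge\chi$: iff both are csv-forced at $w$; $\psi\to\chi$: iff for all structures $\mathcal M'$ and $f$ with $\mathcal I_{\mathcal M}\leqq_f\mathcal I_{\mathcal M'}$, $f(w)\Vdash_{\mathrm G,\mathcal M'}\psi\to\chi$; $\forall v\psi$: iff $w\Vdash^{\mathcal M}_{\mathrm{csv}}\psi(\bar n)$ for all $n\in\omega$; $\exists v\psi$: iff for all $w'\ge w$ there is $n\in\omega$ with $w'\Vdash^{\mathcal M}_{\mathrm{csv}}\psi(\bar n)$. For $X\subseteq\mathrm{SENT}$: $\mathcal J_{\mathrm{csv}}(X)=\{\#\varphi\in\mathrm{SENT}:\forall\mathcal M\,\forall w\in W_{\mathcal M}(\mathcal I_{\mathcal M}(w)=X\Rightarrow w\Vdash^{\mathcal M}_{\mathrm{csv}}\varphi)\}$. *)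

(* Defs.v *)
From mathcomp Require Import all_boot boolp classical_sets.

Set Implicit Arguments.
Unset Strict Implicit.
Unset Printing Implicit Defensive.

(* Besides 0, S, + and *, the language has the finitely many function symbols
   [Ext i]; their primitive recursive definitions are part of [prlang] below. *)
Record sig := Sig { nsym : nat; ext_arity : 'I_nsym -> nat }.

Inductive fsym (S : sig) : Type :=
  | Zero | Succ | Add | Mul | Ext of 'I_(nsym S).
Arguments Zero {S}.
Arguments Succ {S}.
Arguments Add {S}.
Arguments Mul {S}.

Definition arity (S : sig) (f : fsym S) : nat :=
  match f with
  | Zero => 0 | Succ => 1 | Add => 2 | Mul => 2 | Ext i => ext_arity i
  end.

Inductive term (S : sig) : Type :=
  | Var of nat
  | Fn (f : fsym S) of ('I_(arity f) -> term S).
Arguments Var {S}.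

(* [App f ts] is only meant for [size ts = arity f]. *)
Definition App (S : sig) (f : fsym S) (ts : seq (term S)) : term S :=
  Fn (fun i : 'I_(arity f) => nth (Var 0) ts i).

Definition tzero {S : sig} : term S := App Zero [::].
Definition tsucc (S : sig) (t : term S) : term S := App Succ [:: t].
Definition tadd (S : sig) (s t : term S) : term S := App Add [:: s; t].
Definition tmul (S : sig) (s t : term S) : term S := App Mul [:: s; t].
Definition vars_upto {S : sig} (k : nat) : seq (term S) := map Var (iota 0 k).

Fixpoint numeral {S : sig} (n : nat) : term S :=
  if n is m.+1 then tsucc (numeral m) else tzero.

Fixpoint tvars (S : sig) (t : term S) : seq nat :=
  match t with
  | Var x => [:: x]
  | Fn f ts => flatten [seq tvars (ts i) | i <- enum 'I_(arity f)]
  end.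

Definition tclosed (S : sig) (t : term S) : Prop := tvars t = [::].

Fixpoint tsubst (S : sig) (t : term S) (x : nat) (s : term S) : term S :=
  match t with
  | Var y => if y == x then s else Var y
  | Fn f ts => Fn (fun i => tsubst (ts i) x s)
  end.

Fixpoint eval (S : sig) (fi : 'I_(nsym S) -> seq nat -> nat) (e : nat -> nat)
    (t : term S) : nat :=
  match t with
  | Var x => e x
  | Fn f ts =>
      let args := [seq eval fi e (ts i) | i <- enum 'I_(arity f)] in
      match f with
      | Zero => 0
      | Succ => (nth 0 args 0).+1
      | Add => nth 0 args 0 + nth 0 args 1
      | Mul => nth 0 args 0 * nth 0 args 1
      | Ext i => fi i args
      end
  end.

(* With k the arity of f, [Explicit t] stands for
     f(v_0, ..., v_{k-1}) = t(v_0, ..., v_{k-1}),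
   and, for k = n + 1, [Recursive t u] stands for
     f(v_0, ..., v_{n-1}, 0)     = t(v_0, ..., v_{n-1})
     f(v_0, ..., v_{n-1}, S v_n) = u(v_0, ..., v_n, f(v_0, ..., v_n)),
   where the last argument of u is its variable v_{n+1}. *)
Inductive prdef (S : sig) : Type :=
  | Explicit (t : term S)
  | Recursive (t u : term S).

Definition defining_eqs (S : sig) (f : 'I_(nsym S)) (d : prdef S) :
    seq (term S * term S) :=
  match d with
  | Explicit t => [:: (App (Ext f) (vars_upto (ext_arity f)), t)]
  | Recursive t u =>
      let n := (ext_arity f).-1 in
      [:: (App (Ext f) (rcons (vars_upto n) tzero), t);
          (App (Ext f) (rcons (vars_upto n) (tsucc (Var n))),
           tsubst u n.+1 (App (Ext f) (vars_upto n.+1)))]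
  end.

(* Every variable of t is among v_0, ..., v_{k-1}, and every additional symbol
   of t has index smaller than m. *)
Fixpoint term_below (S : sig) (k m : nat) (t : term S) : Prop :=
  match t with
  | Var x => x < k
  | Fn f ts =>
      (if f is Ext i then i < m else true) /\
      (forall i, term_below k m (ts i))
  end.

Definition prdef_wf (S : sig) (f : 'I_(nsym S)) (d : prdef S) : Prop :=
  match d with
  | Explicit t => term_below (ext_arity f) f t
  | Recursive t u =>
      [/\ 0 < ext_arity f, term_below (ext_arity f).-1 f t &
          term_below (ext_arity f).+1 f u]
  end.

(* [fint] is the interpretation of the additional symbols in the standard model;
   since definitions only refer to earlier symbols, it is determined (on lists
   of the right length) by [fintP], and it is primitive recursive. *)
Record prlang := PrLang {
  lsig :> sig;
  fdef : 'I_(nsym lsig) -> prdef lsig;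
  fint : 'I_(nsym lsig) -> seq nat -> nat;
  fdef_wf : forall f, prdef_wf f (fdef f);
  fintP : forall (f : 'I_(nsym lsig)) (e : nat -> nat) (i : nat),
    i < size (defining_eqs f (fdef f)) ->
    let eqn := nth (tzero, tzero) (defining_eqs f (fdef f)) i in
    eval fint e eqn.1 = eval fint e eqn.2
}.

(* The valuation is irrelevant for closed terms. *)
Definition value (L : prlang) (t : term L) : nat :=
  eval (@fint L) (fun _ => 0) t.

Inductive form (S : sig) : Type :=
  | Bot
  | Eq of term S & term S
  | Tr of term S
  | And of form S & form S
  | Or of form S & form S
  | Imp of form S & form S
  | All of nat & form S
  | Ex of nat & form S.
Arguments Bot {S}.

Definition Neg (S : sig) (A : form S) : form S := Imp A Bot.
Definition Iff (S : sig) (A B : form S) : form S := And (Imp A B) (Imp B A).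

Fixpoint fv (S : sig) (A : form S) : seq nat :=
  match A with
  | Bot => [::]
  | Eq s t => tvars s ++ tvars t
  | Tr t => tvars t
  | And B C | Or B C | Imp B C => fv B ++ fv C
  | All x B | Ex x B => [seq y <- fv B | y != x]
  end.

Definition sentence (S : sig) (A : form S) : Prop := fv A = [::].

(* All variables, free or bound. *)
Fixpoint fvars (S : sig) (A : form S) : seq nat :=
  match A with
  | Bot => [::]
  | Eq s t => tvars s ++ tvars t
  | Tr t => tvars t
  | And B C | Or B C | Imp B C => fvars B ++ fvars C
  | All x B | Ex x B => x :: fvars B
  end.

Fixpoint arithmetical (S : sig) (A : form S) : Prop :=
  match A with
  | Bot | Eq _ _ => True
  | Tr _ => False
  | And B C | Or B C | Imp B C => arithmetical B /\ arithmetical C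
  | All _ B | Ex _ B => arithmetical B
  end.

(* Bound variables are not renamed; see [free_for]. *)
Fixpoint subst (S : sig) (A : form S) (x : nat) (t : term S) : form S :=
  match A with
  | Bot => Bot
  | Eq r s => Eq (tsubst r x t) (tsubst s x t)
  | Tr s => Tr (tsubst s x t)
  | And B C => And (subst B x t) (subst C x t)
  | Or B C => Or (subst B x t) (subst C x t)
  | Imp B C => Imp (subst B x t) (subst C x t)
  | All y B => All y (if y == x then B else subst B x t)
  | Ex y B => Ex y (if y == x then B else subst B x t)
  end.

Fixpoint free_for (S : sig) (t : term S) (x : nat) (A : form S) : Prop :=
  match A with
  | Bot | Eq _ _ | Tr _ => True
  | And B C | Or B C | Imp B C => free_for t x B /\ free_for t x C
  | All y B | Ex y B =>
      x \notin fv (All y B) \/ (y \notin tvars t /\ free_for t x B)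
  end.

Fixpoint depth (S : sig) (A : form S) : nat :=
  match A with
  | Bot | Eq _ _ | Tr _ => 0
  | And B C | Or B C | Imp B C => (maxn (depth B) (depth C)).+1
  | All _ B | Ex _ B => (depth B).+1
  end.

Lemma depth_subst (S : sig) (A : form S) (x : nat) (t : term S) :
  depth (subst A x t) = depth A.
Proof.
elim: A => //= [B -> C -> //|B -> C -> //|B -> C -> //|y B IH|y B IH];
  by case: (y == x); rewrite ?IH.
Qed.

(* [CodeSeq.code] is the bijection between finite sequences of natural numbers
   and natural numbers. *)
Definition code_fsym (S : sig) (f : fsym S) : nat :=
  match f with
  | Zero => 0 | Succ => 1 | Add => 2 | Mul => 3 | Ext i => 4 + i
  end.

Fixpoint code_term (S : sig) (t : term S) : nat :=
  match t with
  | Var x => CodeSeq.code [:: 0; x]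
  | Fn f ts =>
      CodeSeq.code (1 :: code_fsym f ::
                    [seq code_term (ts i) | i <- enum 'I_(arity f)])
  end.

Definition code_eq (s t : nat) : nat := CodeSeq.code [:: 3; s; t].
Definition code_tr (t : nat) : nat := CodeSeq.code [:: 4; t].
Definition code_and (a b : nat) : nat := CodeSeq.code [:: 5; a; b].
Definition code_or (a b : nat) : nat := CodeSeq.code [:: 6; a; b].
Definition code_imp (a b : nat) : nat := CodeSeq.code [:: 7; a; b].
Definition code_all (v a : nat) : nat := CodeSeq.code [:: 8; v; a].
Definition code_ex (v a : nat) : nat := CodeSeq.code [:: 9; v; a].

(* In a quantified formula, the variable is coded as a term. *)
Fixpoint code (S : sig) (A : form S) : nat :=
  match A with
  | Bot => CodeSeq.code [:: 2]
  | Eq s t => code_eq (code_term s) (code_term t)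
  | Tr t => code_tr (code_term t)
  | And B C => code_and (code B) (code C)
  | Or B C => code_or (code B) (code C)
  | Imp B C => code_imp (code B) (code C)
  | All x B => code_all (code_term (@Var S x)) (code B)
  | Ex x B => code_ex (code_term (@Var S x)) (code B)
  end.

Definition quote (S : sig) (A : form S) : term S := numeral (code A).

Definition SENT (S : sig) : set nat :=
  [set n | exists A : form S, sentence A /\ n = code A].

Definition CTERM (S : sig) : set nat :=
  [set n | exists t : term S, tclosed t /\ n = code_term t].

(* The graph of the function taking the code of a closed term to its value. *)
Definition VAL (L : prlang) (n m : nat) : Prop :=
  exists t : term L, [/\ tclosed t, n = code_term t & m = value t].

Inductive HA_scheme (L : prlang) : form L -> Prop :=
  | ax_K A B : HA_scheme (Imp A (Imp B A))
  | ax_S A B C :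
      HA_scheme (Imp (Imp A (Imp B C)) (Imp (Imp A B) (Imp A C)))
  | ax_andI A B : HA_scheme (Imp A (Imp B (And A B)))
  | ax_andEl A B : HA_scheme (Imp (And A B) A)
  | ax_andEr A B : HA_scheme (Imp (And A B) B)
  | ax_orIl A B : HA_scheme (Imp A (Or A B))
  | ax_orIr A B : HA_scheme (Imp B (Or A B))
  | ax_orE A B C : HA_scheme (Imp (Imp A C) (Imp (Imp B C) (Imp (Or A B) C)))
  | ax_botE A : HA_scheme (Imp Bot A)
  | ax_allE x A t : free_for t x A -> HA_scheme (Imp (All x A) (subst A x t))
  | ax_allD x A B :
      HA_scheme (Imp (All x (Imp A B)) (Imp (All x A) (All x B)))
  | ax_allI x A : x \notin fv A -> HA_scheme (Imp A (All x A))
  | ax_exI x A t : free_for t x A -> HA_scheme (Imp (subst A x t) (Ex x A))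
  | ax_exE x A B : x \notin fv B ->
      HA_scheme (Imp (All x (Imp A B)) (Imp (Ex x A) B))
  | ax_refl t : HA_scheme (Eq t t)
  | ax_leibniz x A s t : free_for s x A -> free_for t x A ->
      HA_scheme (Imp (Eq s t) (Imp (subst A x s) (subst A x t)))
  | ax_succ0 t : HA_scheme (Neg (Eq (tsucc t) tzero))
  | ax_succI s t : HA_scheme (Imp (Eq (tsucc s) (tsucc t)) (Eq s t))
  | ax_add0 s : HA_scheme (Eq (tadd s tzero) s)
  | ax_addS s t : HA_scheme (Eq (tadd s (tsucc t)) (tsucc (tadd s t)))
  | ax_mul0 s : HA_scheme (Eq (tmul s tzero) tzero)
  | ax_mulS s t : HA_scheme (Eq (tmul s (tsucc t)) (tadd (tmul s t) s))
  | ax_def (f : 'I_(nsym L)) i : i < size (defining_eqs f (fdef f)) ->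
      let eqn := nth (tzero, tzero) (defining_eqs f (fdef f)) i in
      HA_scheme (Eq eqn.1 eqn.2)
  | ax_ind x A :
      HA_scheme (Imp (subst A x tzero)
                (Imp (All x (Imp A (subst A x (tsucc (Var x))))) (All x A))).

(* The closed axioms are the universal closures of the instances of the schemes,
   so that modus ponens is the only rule of inference needed. *)
Definition HAT_axiom (L : prlang) (A : form L) : Prop :=
  exists (xs : seq nat) (B : form L),
    [/\ HA_scheme B, A = foldr (@All L) B xs & sentence A].

Definition AX_HAT (L : prlang) : set nat :=
  [set n | exists A : form L, HAT_axiom A /\ n = code A].

Inductive HA_provable (L : prlang) : form L -> Prop :=
  | HA_ax A : HAT_axiom A -> arithmetical A -> HA_provable A
  | HA_mp A B : HA_provable (Imp A B) -> HA_provable A -> HA_provable B.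

(* Numeralwise representation in HA, by formulas in the variable v_0
   (resp. the variables v_0, v_1). *)
Definition represents1 (L : prlang) (P : form L) (X : set nat) : Prop :=
  [/\ arithmetical P,
      {subset fv P <= [:: 0]},
      (forall n, X n -> HA_provable (subst P 0 (numeral n))) &
      (forall n, ~ X n -> HA_provable (Neg (subst P 0 (numeral n))))].

Definition represents2 (L : prlang) (P : form L) (R : nat -> nat -> Prop) :
    Prop :=
  [/\ arithmetical P,
      {subset fv P <= [:: 0; 1]},
      (forall n m, R n m ->
         HA_provable (subst (subst P 0 (numeral n)) 1 (numeral m))) &
      (forall n m, ~ R n m ->
         HA_provable (Neg (subst (subst P 0 (numeral n)) 1 (numeral m))))].

Definition is_op1 (L : prlang) (f : 'I_(nsym L)) (g : nat -> nat) : Prop :=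
  ext_arity f = 1 /\ forall a, fint f [:: a] = g a.

Definition is_op2 (L : prlang) (f : 'I_(nsym L)) (g : nat -> nat -> nat) :
    Prop :=
  ext_arity f = 2 /\ forall a b, fint f [:: a; b] = g a b.

(* The additional symbols include the dotted syntactic operations. The relation
   "the closed term coded by t has value y" is given by a formula, as it cannot be
   a function symbol of the language itself (by diagonalization). *)
Record syntax (L : prlang) := Syntax {
  d_eq : 'I_(nsym L);
  d_tr : 'I_(nsym L);
  d_and : 'I_(nsym L);
  d_or : 'I_(nsym L);
  d_imp : 'I_(nsym L);
  d_all : 'I_(nsym L);
  d_ex : 'I_(nsym L);
  d_num : 'I_(nsym L);
  d_sub : 'I_(nsym L);
  d_eqP : is_op2 d_eq code_eq;
  d_trP : is_op1 d_tr code_tr;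
  d_andP : is_op2 d_and code_and;
  d_orP : is_op2 d_or code_or;
  d_impP : is_op2 d_imp code_imp;
  d_allP : is_op2 d_all code_all;
  d_exP : is_op2 d_ex code_ex;
  d_numP : is_op1 d_num (fun n => code_term (@numeral L n));
  d_subP : ext_arity d_sub = 3 /\
    forall (A : form L) (t : term L) (v : nat), tclosed t ->
      fint d_sub [:: code A; code_term t; code_term (@Var L v)] =
      code (subst A v t);
  f_sent : form L;
  f_cterm : form L;
  f_val : form L;
  f_axhat : form L;
  f_sentP : represents1 f_sent (SENT L);
  f_ctermP : represents1 f_cterm (CTERM L);
  f_valP : represents2 f_val (@VAL L);
  f_axhatP : represents1 f_axhat (AX_HAT L)
}.

Definition op1 (L : prlang) (f : 'I_(nsym L)) (t : term L) : term L :=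
  App (Ext f) [:: t].
Definition op2 (L : prlang) (f : 'I_(nsym L)) (s t : term L) : term L :=
  App (Ext f) [:: s; t].

Definition d_neg (L : prlang) (D : syntax L) (t : term L) : term L :=
  op2 (d_imp D) t (quote Bot).

(* Code of the result of substituting (the term coded by) t for v in x. *)
Definition d_subst (L : prlang) (D : syntax L) (x t v : term L) : term L :=
  App (Ext (d_sub D)) [:: x; t; v].

(* [var D i], i = 0, 1, ..., are variables larger than v_1 and than all variables
   of the representing formulas, so that substituting terms in these variables
   into the representing formulas captures no variable. *)
Definition var (L : prlang) (D : syntax L) (i : nat) : nat :=
  i + (\max_(y <- 1 :: fvars (f_sent D) ++ fvars (f_cterm D) ++
                   fvars (f_val D) ++ fvars (f_axhat D)) y).+1.

Definition Sent (L : prlang) (D : syntax L) (t : term L) : form L :=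
  subst (f_sent D) 0 t.
Definition AxHAT (L : prlang) (D : syntax L) (t : term L) : form L :=
  subst (f_axhat D) 0 t.

(* Quantification over (codes of) closed terms. *)
Definition AllT (L : prlang) (D : syntax L) (x : nat) (A : form L) : form L :=
  All x (Imp (subst (f_cterm D) 0 (Var x)) A).
Definition ExT (L : prlang) (D : syntax L) (x : nat) (A : form L) : form L :=
  Ex x (And (subst (f_cterm D) 0 (Var x)) A).

(* A(y) for the value y of the closed term coded by t. *)
Definition atValue (L : prlang) (D : syntax L) (t : term L) (y : nat)
    (A : form L) : form L :=
  Ex y (And (subst (subst (f_val D) 0 t) 1 (Var y)) A).

Record structure (L : prlang) := Structure {
  world :> Type;
  le : world -> world -> Prop;
  le_refl : forall w, le w w;
  le_trans : forall u v w, le u v -> le v w -> le u w;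
  le_anti : forall u v, le u v -> le v u -> u = v;
  interp : world -> set nat;
  interp_sent : forall w, (interp w `<=` SENT L)%classic;
  interp_mono : forall u v, le u v -> (interp u `<=` interp v)%classic
}.

(* The clauses for the quantifiers call for a recursion on the depth of the
   sentence, bounded by d; see the equations below. *)
Fixpoint gforces_rec (L : prlang) (M : structure L) (d : nat) (w : M)
    (A : form L) : Prop :=
  if d isn't d'.+1 then False else
  match A with
  | Bot => False
  | Eq s t => value s = value t
  | Tr s => interp w (value s)
  | And B C => gforces_rec d' w B /\ gforces_rec d' w C
  | Or B C =>
      (forall w', le w w' -> gforces_rec d' w' B) \/
      (forall w', le w w' -> gforces_rec d' w' C)
  | Imp B C =>
      forall w', le w w' -> gforces_rec d' w' B -> gforces_rec d' w' C
  | All x B => forall n, gforces_rec d' w (subst B x (numeral n))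
  | Ex x B =>
      forall w', le w w' -> exists n, gforces_rec d' w' (subst B x (numeral n))
  end.

Definition gforces (L : prlang) (M : structure L) (w : M) (A : form L) : Prop :=
  gforces_rec (depth A).+1 w A.

Definition gvalid (L : prlang) (M : structure L) (A : form L) : Prop :=
  forall w : M, gforces w A.

Definition embedding (L : prlang) (M M' : structure L) (f : M -> M') : Prop :=
  [/\ injective f,
      (forall w0 w1, le w0 w1 <-> le (f w0) (f w1)) &
      (forall w, (interp w `<=` interp (f w))%classic)].

Fixpoint csv_rec (L : prlang) (M : structure L) (d : nat) (w : M)
    (A : form L) : Prop :=
  if d isn't d'.+1 then False else
  match A with
  | Bot | Eq _ _ | Tr _ => gforces w A
  | And B C => csv_rec d' w B /\ csv_rec d' w C
  | Or B C =>
      (forall w', le w w' -> csv_rec d' w' B) \/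
      (forall w', le w w' -> csv_rec d' w' C)
  | Imp B C =>
      forall (M' : structure L) (f : M -> M'),
        embedding f -> gforces (f w) (Imp B C)
  | All x B => forall n, csv_rec d' w (subst B x (numeral n))
  | Ex x B =>
      forall w', le w w' -> exists n, csv_rec d' w' (subst B x (numeral n))
  end.

Definition csv (L : prlang) (M : structure L) (w : M) (A : form L) : Prop :=
  csv_rec (depth A).+1 w A.

Lemma gforces_recE (L : prlang) (M : structure L) (d : nat) (A : form L) :
  depth A < d -> forall w : M, gforces_rec d w A = gforces w A.
Proof.
suff H d1 : forall d2 A, depth A < d1 -> depth A < d2 ->
    forall w : M, gforces_rec d1 w A = gforces_rec d2 w A.
  by move=> lt w; apply: H.
elim: d1 => [|d1 IH] // [|d2] // [] //=.
- by move=> B C; rewrite !ltnS !gtn_max => /andP[? ?] /andP[? ?] w;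
    rewrite !(IH d2).
- move=> B C; rewrite !ltnS !gtn_max => /andP[? ?] /andP[? ?] w.
  by congr (_ \/ _); apply: eq_forall => w'; apply: eq_forall => _;
    rewrite (IH d2).
- move=> B C; rewrite !ltnS !gtn_max => /andP[? ?] /andP[? ?] w.
  by apply: eq_forall => w'; apply: eq_forall => _; rewrite !(IH d2).
- by move=> x B ? ? w; apply: eq_forall => n; rewrite (IH d2) ?depth_subst.
- move=> x B ? ? w; apply: eq_forall => w'; apply: eq_forall => _.
  by apply: eq_exists => n; rewrite (IH d2) ?depth_subst.
Qed.

Lemma csv_recE (L : prlang) (M : structure L) (d : nat) (A : form L) :
  depth A < d -> forall w : M, csv_rec d w A = csv w A.
Proof.
suff H d1 : forall d2 A, depth A < d1 -> depth A < d2 ->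
    forall w : M, csv_rec d1 w A = csv_rec d2 w A.
  by move=> lt w; apply: H.
elim: d1 => [|d1 IH] // [|d2] // [] //=.
- by move=> B C; rewrite !ltnS !gtn_max => /andP[? ?] /andP[? ?] w;
    rewrite !(IH d2).
- move=> B C; rewrite !ltnS !gtn_max => /andP[? ?] /andP[? ?] w.
  by congr (_ \/ _); apply: eq_forall => w'; apply: eq_forall => _;
    rewrite (IH d2).
- by move=> x B ? ? w; apply: eq_forall => n; rewrite (IH d2) ?depth_subst.
- move=> x B ? ? w; apply: eq_forall => w'; apply: eq_forall => _.
  by apply: eq_exists => n; rewrite (IH d2) ?depth_subst.
Qed.

Lemma gforces_Bot (L : prlang) (M : structure L) (w : M) :
  gforces w Bot = False.
Proof. by []. Qed.

Lemma gforces_Eq (L : prlang) (M : structure L) (w : M) (s t : term L) :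
  gforces w (Eq s t) = (value s = value t).
Proof. by []. Qed.

Lemma gforces_Tr (L : prlang) (M : structure L) (w : M) (s : term L) :
  gforces w (Tr s) = interp w (value s).
Proof. by []. Qed.

Lemma gforces_And (L : prlang) (M : structure L) (w : M) (B C : form L) :
  gforces w (And B C) = (gforces w B /\ gforces w C).
Proof.
have ltB : depth B < depth (And B C) by rewrite ltnS leq_maxl.
have ltC : depth C < depth (And B C) by rewrite ltnS leq_maxr.
rewrite {1}/gforces; move: (depth (And B C)) ltB ltC => d ltB ltC /=.
by rewrite !gforces_recE.
Qed.

Lemma gforces_Or (L : prlang) (M : structure L) (w : M) (B C : form L) :
  gforces w (Or B C) =
  ((forall w', le w w' -> gforces w' B) \/
   (forall w', le w w' -> gforces w' C)).
Proof.
have ltB : depth B < depth (Or B C) by rewrite ltnS leq_maxl.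
have ltC : depth C < depth (Or B C) by rewrite ltnS leq_maxr.
rewrite {1}/gforces; move: (depth (Or B C)) ltB ltC => d ltB ltC /=.
by congr (_ \/ _); apply: eq_forall => w'; apply: eq_forall => _;
  rewrite gforces_recE.
Qed.

Lemma gforces_Imp (L : prlang) (M : structure L) (w : M) (B C : form L) :
  gforces w (Imp B C) =
  (forall w', le w w' -> gforces w' B -> gforces w' C).
Proof.
have ltB : depth B < depth (Imp B C) by rewrite ltnS leq_maxl.
have ltC : depth C < depth (Imp B C) by rewrite ltnS leq_maxr.
rewrite {1}/gforces; move: (depth (Imp B C)) ltB ltC => d ltB ltC /=.
by apply: eq_forall => w'; apply: eq_forall => _; rewrite !gforces_recE.
Qed.

Lemma gforces_All (L : prlang) (M : structure L) (w : M) x (B : form L) :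
  gforces w (All x B) = (forall n, gforces w (subst B x (numeral n))).
Proof.
have ltB : depth B < depth (All x B) by [].
rewrite {1}/gforces; move: (depth (All x B)) ltB => d ltB /=.
by apply: eq_forall => n; rewrite gforces_recE // depth_subst.
Qed.

Lemma gforces_Ex (L : prlang) (M : structure L) (w : M) x (B : form L) :
  gforces w (Ex x B) =
  (forall w', le w w' -> exists n, gforces w' (subst B x (numeral n))).
Proof.
have ltB : depth B < depth (Ex x B) by [].
rewrite {1}/gforces; move: (depth (Ex x B)) ltB => d ltB /=.
apply: eq_forall => w'; apply: eq_forall => _.
by apply: eq_exists => n; rewrite gforces_recE // depth_subst.
Qed.

Lemma csv_Bot (L : prlang) (M : structure L) (w : M) :
  csv w Bot = gforces w Bot.
Proof. by []. Qed.

Lemma csv_Eq (L : prlang) (M : structure L) (w : M) (s t : term L) :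
  csv w (Eq s t) = gforces w (Eq s t).
Proof. by []. Qed.

Lemma csv_Tr (L : prlang) (M : structure L) (w : M) (s : term L) :
  csv w (Tr s) = gforces w (Tr s).
Proof. by []. Qed.

Lemma csv_And (L : prlang) (M : structure L) (w : M) (B C : form L) :
  csv w (And B C) = (csv w B /\ csv w C).
Proof.
have ltB : depth B < depth (And B C) by rewrite ltnS leq_maxl.
have ltC : depth C < depth (And B C) by rewrite ltnS leq_maxr.
rewrite {1}/csv; move: (depth (And B C)) ltB ltC => d ltB ltC /=.
by rewrite !csv_recE.
Qed.

Lemma csv_Or (L : prlang) (M : structure L) (w : M) (B C : form L) :
  csv w (Or B C) =
  ((forall w', le w w' -> csv w' B) \/ (forall w', le w w' -> csv w' C)).
Proof.
have ltB : depth B < depth (Or B C) by rewrite ltnS leq_maxl.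
have ltC : depth C < depth (Or B C) by rewrite ltnS leq_maxr.
rewrite {1}/csv; move: (depth (Or B C)) ltB ltC => d ltB ltC /=.
by congr (_ \/ _); apply: eq_forall => w'; apply: eq_forall => _;
  rewrite csv_recE.
Qed.

Lemma csv_Imp (L : prlang) (M : structure L) (w : M) (B C : form L) :
  csv w (Imp B C) =
  (forall (M' : structure L) (f : M -> M'),
     embedding f -> gforces (f w) (Imp B C)).
Proof. by []. Qed.

Lemma csv_All (L : prlang) (M : structure L) (w : M) x (B : form L) :
  csv w (All x B) = (forall n, csv w (subst B x (numeral n))).
Proof.
have ltB : depth B < depth (All x B) by [].
rewrite {1}/csv; move: (depth (All x B)) ltB => d ltB /=.
by apply: eq_forall => n; rewrite csv_recE // depth_subst.
Qed.

Lemma csv_Ex (L : prlang) (M : structure L) (w : M) x (B : form L) :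
  csv w (Ex x B) =
  (forall w', le w w' -> exists n, csv w' (subst B x (numeral n))).
Proof.
have ltB : depth B < depth (Ex x B) by [].
rewrite {1}/csv; move: (depth (Ex x B)) ltB => d ltB /=.
apply: eq_forall => w'; apply: eq_forall => _.
by apply: eq_exists => n; rewrite csv_recE // depth_subst.
Qed.

Definition J_csv (L : prlang) (X : set nat) : set nat :=
  [set n | exists A : form L,
     [/\ sentence A, n = code A &
         forall (M : structure L) (w : M), interp w = X -> csv w A]].

Definition fixed_point_model (L : prlang) (M : structure L) : Prop :=
  forall w : M, interp w = J_csv L (interp w).

Inductive CSV_axiom (L : prlang) (D : syntax L) : form L -> Prop :=
  | CSV_eq :
      let s := var D 0 in let t := var D 1 in
      let y := var D 2 in let z := var D 3 in
      let eq_st := op2 (d_eq D) (Var s) (Var t) in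
      let val_eq_st := atValue D (Var s) y (atValue D (Var t) z
                         (Eq (Var y) (Var z))) in
      CSV_axiom D (AllT D s (AllT D t
        (And (Iff (Tr eq_st) val_eq_st)
             (Iff (Tr (d_neg D eq_st)) (Neg val_eq_st)))))
  | CSV_or :
      let x := var D 0 in let y := var D 1 in
      let x_or_y := op2 (d_or D) (Var x) (Var y) in
      CSV_axiom D (All x (All y (Imp (Sent D x_or_y)
        (Iff (Tr x_or_y) (Or (Tr (Var x)) (Tr (Var y)))))))
  | CSV_and :
      let x := var D 0 in let y := var D 1 in
      let x_and_y := op2 (d_and D) (Var x) (Var y) in
      CSV_axiom D (All x (All y (Imp (Sent D x_and_y)
        (Iff (Tr x_and_y) (And (Tr (Var x)) (Tr (Var y)))))))
  | CSV_ex :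
      let x := var D 0 in let v := var D 1 in let t := var D 2 in
      let ex_vx := op2 (d_ex D) (Var v) (Var x) in
      CSV_axiom D (All x (All v (Imp (Sent D ex_vx)
        (Iff (Tr ex_vx)
             (ExT D t (Tr (d_subst D (Var x) (Var t) (Var v))))))))
  | CSV_all :
      let x := var D 0 in let v := var D 1 in let t := var D 2 in
      let all_vx := op2 (d_all D) (Var v) (Var x) in
      CSV_axiom D (All x (All v (Imp (Sent D all_vx)
        (Iff (Tr all_vx)
             (AllT D t (Tr (d_subst D (Var x) (Var t) (Var v))))))))
  | CSV_imp :
      let x := var D 0 in let y := var D 1 in
      let x_imp_y := op2 (d_imp D) (Var x) (Var y) in
      CSV_axiom D (All x (All y (Imp (Sent D x_imp_y)
        (Imp (Tr x_imp_y) (Imp (Tr (Var x)) (Tr (Var y)))))))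
  | CSV_tr :
      let t := var D 0 in let y := var D 1 in
      CSV_axiom D (AllT D t
        (Iff (atValue D (Var t) y (Tr (Var y))) (Tr (op1 (d_tr D) (Var t)))))
  | CSV_HAT :
      let x := var D 0 in
      CSV_axiom D (All x (Imp (AxHAT D (Var x)) (Tr (Var x))))
  | CSV_cons :
      let x := var D 0 in
      CSV_axiom D (All x
        (Imp (And (Tr (Var x)) (Tr (d_neg D (Var x)))) Bot))
  | CSV_sent :
      (* the code of Tr(v) -> Sent(v) with the numeral of x substituted for v *)
      let x := var D 0 in let v := var D 1 in
      CSV_axiom D (All x (Tr (d_subst D
        (quote (Imp (Tr (Var v)) (Sent D (Var v))))
        (op1 (d_num D) (Var x))
        (numeral (code_term (@Var L v))))))
  | CSV_out (A : form L) : sentence A -> CSV_axiom D (Imp (Tr (quote A)) A).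

(* Main.v *)
(* Compositional supervaluation is the same as global forcing in all extensions.
   The only cases in question are disjunction and existence: if some extension of
   M refutes B at w and another one refutes C, then gluing both on top of M gives
   a single extension whose world w lies below both countermodels and hence
   refutes B \/ C; likewise for countably many extensions.

   Every structure with a world w such that X is included in I(w) is an extension
   of the one-world structure X. Hence membership in a fixed point X = J_csv(X) is
   csv-forcing at the one-world structure X, and also global forcing at all worlds
   whose interpretation includes X. The compositional axioms are read off the
   first form; Tr-out, consistency, the implication axiom and the truth of the HAT
   axioms follow from the second and from the soundness of intuitionistic
   arithmetic in Kripke structures with constant domain omega. *)

From mathcomp Require Import all_boot boolp classical_sets.
Require Import Defs.

Set Implicit Arguments.
Unset Strict Implicit.
Unset Printing Implicit Defensive.

(** * Environments, and evaluation and substitution in terms *)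

Definition upd (e : nat -> nat) (x n : nat) : nat -> nat :=
  fun y => if y == x then n else e y.

Lemma upd_same e x m n : upd (upd e x m) x n = upd e x n.
Proof. by apply: funext => y; rewrite /upd; case: eqP. Qed.

Lemma upd_swap e x y m n :
  x != y -> upd (upd e x m) y n = upd (upd e y n) x m.
Proof.
move=> xy; apply: funext => z; rewrite /upd.
by case: (z =P y) => // ->; rewrite eq_sym (negbTE xy).
Qed.

Lemma mem_tvars (S : sig) (f : fsym S) (ts : 'I_(arity f) -> term S) i y :
  y \in tvars (ts i) -> y \in tvars (Fn ts).
Proof.
move=> yi; apply/flattenP; exists (tvars (ts i)) => //.
by apply/mapP; exists i; rewrite ?mem_enum.
Qed.

(** Whatever [f] is, [eval] sees the arguments only through the list of their values. *)
Lemma eval_Fn_eq (S : sig) fi e1 e2 (f : fsym S)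
    (ts us : 'I_(arity f) -> term S) :
  (forall i, eval fi e1 (ts i) = eval fi e2 (us i)) ->
  eval fi e1 (Fn ts) = eval fi e2 (Fn us).
Proof.
move=> eq_ts /=.
have -> // : [seq eval fi e1 (ts i) | i <- enum 'I_(arity f)] =
    [seq eval fi e2 (us i) | i <- enum 'I_(arity f)] by apply: eq_map.
Qed.

Lemma eval_agree (S : sig) fi e1 e2 (t : term S) :
  {in tvars t, e1 =1 e2} -> eval fi e1 t = eval fi e2 t.
Proof.
elim: t => [x|f ts IH] e12; first by apply: e12; rewrite inE.
by apply: eval_Fn_eq => i; apply: IH => y /mem_tvars; apply: e12.
Qed.

Lemma eval_tsubst (S : sig) fi e (t : term S) x s :
  eval fi e (tsubst t x s) = eval fi (upd e x (eval fi e s)) t.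
Proof.
elim: t => [y|f ts IH]; first by rewrite /= /upd; case: eqP.
exact: eval_Fn_eq.
Qed.

Lemma tsubst_id (S : sig) (t : term S) x s :
  x \notin tvars t -> tsubst t x s = t.
Proof.
elim: t => [y|f ts IH] /=; first by rewrite inE eq_sym; case: eqP.
move=> xts; congr Fn; apply: funext => i; apply: IH.
by apply: contra xts; apply: mem_tvars.
Qed.

Lemma tvars_tsubst (S : sig) (t : term S) x s y :
  y \in tvars (tsubst t x s) -> y \in tvars t /\ y != x \/ y \in tvars s.
Proof.
elim: t => [z|f ts IH] /=.
  case: eqP => [_|/eqP zx]; first by right.
  by rewrite /= !inE => /eqP ->; left; rewrite eqxx.
move=> /flattenP[zs /mapP[i _ ->] /IH[[yi yx]|]]; last by right.
by left; split => //; apply: (mem_tvars yi).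
Qed.

(** [App] turns a list of arguments into a function on ordinals; for a list of the right length,
    enumerating the ordinals gives the list back. *)
Lemma map_enum_nth (T U : Type) (g : T -> U) (x : T) (s : seq T) n :
  size s = n -> [seq g (nth x s i) | i : 'I_n <- enum 'I_n] = map g s.
Proof.
move=> <-; rewrite (map_comp (fun k : nat => g (nth x s k)) (@nat_of_ord _)).
rewrite val_enum_ord.
by rewrite (map_comp g) map_nth_iota0 // take_size.
Qed.

Lemma eval_App_Ext (S : sig) fi e (f : 'I_(nsym S)) (ts : seq (term S)) :
  size ts = ext_arity f -> eval fi e (App (Ext f) ts) =
  fi f (map (eval fi e) ts).
Proof. by move=> szts /=; rewrite map_enum_nth. Qed.

Lemma eval_tsucc (S : sig) fi e (t : term S) :
  eval fi e (tsucc t) = (eval fi e t).+1.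
Proof. by rewrite /= !enum_ordSl. Qed.

Lemma eval_tadd (S : sig) fi e (s t : term S) :
  eval fi e (tadd s t) = eval fi e s + eval fi e t.
Proof. by rewrite /= !enum_ordSl. Qed.

Lemma eval_tmul (S : sig) fi e (s t : term S) :
  eval fi e (tmul s t) = eval fi e s * eval fi e t.
Proof. by rewrite /= !enum_ordSl. Qed.

Lemma eval_numeral (S : sig) fi e n : eval fi e (@numeral S n) = n.
Proof. by elim: n => [//|n IH]; rewrite eval_tsucc IH. Qed.

Lemma tvars_tsucc (S : sig) (t : term S) : tvars (tsucc t) = tvars t.
Proof. by rewrite /= enum_ordSl enum_ord0 /= cats0. Qed.

Lemma tvars_numeral (S : sig) n : tvars (@numeral S n) = [::].
Proof.
by elim: n => [|n IH]; [rewrite /= enum_ord0|rewrite tvars_tsucc].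
Qed.

(** * Bound variables, capture and substitution in formulas *)

Fixpoint bvars (S : sig) (A : form S) : seq nat :=
  match A with
  | Bot | Eq _ _ | Tr _ => [::]
  | And B C | Or B C | Imp B C => bvars B ++ bvars C
  | All x B | Ex x B => x :: bvars B
  end.

Lemma bvars_subst (S : sig) (A : form S) x t : bvars (subst A x t) = bvars A.
Proof.
by elim: A => //= [? -> ? ->|? -> ? ->|? -> ? ->|y B IH|y B IH] //;
  case: eqP; rewrite ?IH.
Qed.

Lemma bvars_fvars (S : sig) (A : form S) : {subset bvars A <= fvars A}.
Proof.
elim: A => //= [B IHB C IHC|B IHB C IHC|B IHB C IHC|x B IH|x B IH] y;
  rewrite ?mem_cat ?inE.
1-3: by case/orP => [/IHB|/IHC] ->; rewrite ?orbT.
1-2: by case/orP => [|/IH] ->; rewrite ?orbT.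
Qed.

(** This criterion survives earlier substitutions into [A], since [subst] leaves the binders as they
    are. *)
Lemma free_for_bvars (S : sig) (A : form S) x t :
  (forall y, y \in tvars t -> y \notin bvars A) -> free_for t x A.
Proof.
elim: A => //= [B IHB C IHC|B IHB C IHC|B IHB C IHC|z B IH|z B IH] tA.
1-3: by split; [apply: IHB|apply: IHC] => y /tA; rewrite mem_cat => /norP[].
1-2: right; split; first by apply/negP => /tA; rewrite inE eqxx.
1-2: by apply: IH => y /tA; rewrite inE => /norP[].
Qed.

Lemma free_for_closed (S : sig) (A : form S) x t : tclosed t -> free_for t x A.
Proof. by move=> ct; apply: free_for_bvars; rewrite ct. Qed.

(** Only a binder of [x] could capture a variable of [t], and [x] is not free in a formula that
    starts with one. Used for [tsucc (Var x)] in the induction scheme. *)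
Lemma free_for_self (S : sig) (A : form S) x t :
  tvars t = [:: x] -> free_for t x A.
Proof.
move=> tx; elim: A => //= z B IH;
  (have [->|zx] := eqVneq z x; [left|right; split => //]);
  by rewrite ?tx ?inE ?mem_filter ?eqxx.
Qed.

Lemma subst_id (S : sig) (A : form S) x t : x \notin fv A -> subst A x t = A.
Proof.
elim: A => //=.
- by move=> r s; rewrite mem_cat => /norP[? ?]; rewrite !tsubst_id.
- by move=> s ?; rewrite tsubst_id.
1-3: by move=> B IHB C IHC; rewrite mem_cat => /norP[? ?]; rewrite IHB ?IHC.
1-2: by move=> y B IH; rewrite mem_filter eq_sym; case: eqP => //= _ /IH ->.
Qed.

Lemma fv_subst (S : sig) (A : form S) x t y :
  y \in fv (subst A x t) -> y \in fv A /\ y != x \/ y \in tvars t.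
Proof.
elim: A => //=.
- by move=> r s; rewrite !mem_cat => /orP[] /tvars_tsubst[[-> ->]|->];
    rewrite ?orbT; auto.
- by move=> s /tvars_tsubst.
1-3: by move=> B IHB C IHC; rewrite !mem_cat => /orP[/IHB|/IHC] [[-> ->]|->];
    rewrite ?orbT; auto.
1-2: move=> z B IH; rewrite !mem_filter; case: (z =P x) => [->|_];
    [by case/andP=> -> ->; left|by case/andP=> -> /IH].
Qed.

Lemma sentence_subst (S : sig) (A : form S) x t :
  {subset fv A <= [:: x]} -> tclosed t -> sentence (subst A x t).
Proof.
move=> fvA ct; rewrite /sentence.
case E: (fv _) => [//|y s]; have : y \in fv (subst A x t) by rewrite E mem_head.
by case/fv_subst => [[/fvA]|]; rewrite ?ct // inE => ->.
Qed.

(** * Forcing with environments, and soundness of arithmetic *)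

(* Forcing with an environment for the free variables; by persistence, the local
   clauses for Or and Ex agree with the global ones. *)
Fixpoint sat (L : prlang) (M : structure L) (w : M) (e : nat -> nat)
    (A : form L) : Prop :=
  match A with
  | Bot => False
  | Eq s t => eval (@fint L) e s = eval (@fint L) e t
  | Tr s => interp w (eval (@fint L) e s)
  | And B C => sat w e B /\ sat w e C
  | Or B C => sat w e B \/ sat w e C
  | Imp B C => forall w', le w w' -> sat w' e B -> sat w' e C
  | All x B => forall n, sat w (upd e x n) B
  | Ex x B => exists n, sat w (upd e x n) B
  end.

Section Forcing.
Variables (L : prlang) (M : structure L).
Implicit Types (w : M) (e : nat -> nat) (A B : form L).

Lemma sat_mono A w w' e : le w w' -> sat w e A -> sat w' e A.
Proof.
elim: A w w' e => //=.
- by move=> s w w' e /interp_mono; apply.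
- by move=> B IHB C IHC w w' e ww' [/(IHB _ _ _ ww') ? /(IHC _ _ _ ww')].
- by move=> B IHB C IHC w w' e ww' [/(IHB _ _ _ ww')|/(IHC _ _ _ ww')]; auto.
- by move=> B _ C _ w w' e ww' BC u w'u; apply: BC; apply: le_trans w'u.
- by move=> x B IH w w' e ww' wB n; apply: IH (wB n).
- by move=> x B IH w w' e ww' [n wB]; exists n; apply: IH wB.
Qed.

Lemma sat_agree A w e1 e2 :
  {in fv A, e1 =1 e2} -> sat w e1 A = sat w e2 A.
Proof.
elim: A w e1 e2 => //=.
- move=> s t w e1 e2 e12.
  by rewrite !(@eval_agree _ _ e1 e2) // => y yst; apply: e12;
    rewrite mem_cat yst ?orbT.
- by move=> s w e1 e2 e12; rewrite (eval_agree _ e12).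
- move=> B IHB C IHC w e1 e2 e12.
  by rewrite (IHB _ e1 e2) ?(IHC _ e1 e2) // => y yst; apply: e12;
    rewrite mem_cat yst ?orbT.
- move=> B IHB C IHC w e1 e2 e12.
  by rewrite (IHB _ e1 e2) ?(IHC _ e1 e2) // => y yst; apply: e12;
    rewrite mem_cat yst ?orbT.
- move=> B IHB C IHC w e1 e2 e12; apply: eq_forall => w'.
  by rewrite (IHB _ e1 e2) ?(IHC _ e1 e2) // => y yst; apply: e12;
    rewrite mem_cat yst ?orbT.
- move=> x B IH w e1 e2 e12; apply: eq_forall => n; apply: IH => y yB.
  by rewrite /upd; case: eqP => // /eqP yx; apply: e12; rewrite mem_filter yx.
- move=> x B IH w e1 e2 e12; apply: eq_exists => n; apply: IH => y yB.
  by rewrite /upd; case: eqP => // /eqP yx; apply: e12; rewrite mem_filter yx.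
Qed.

Lemma sat_upd_fresh A w e x n : x \notin fv A ->
  sat w (upd e x n) A = sat w e A.
Proof.
move=> xA; apply: sat_agree => y yA; rewrite /upd; case: eqP => // yx.
by rewrite -yx yA in xA.
Qed.

(** Under a binder other than [x], either [x] is not free in the body and both sides ignore it, or
    the bound variable does not occur in [t], whose value then ignores the inner update. *)
Lemma sat_subst A w e x t : free_for t x A ->
  sat w e (subst A x t) = sat w (upd e x (eval (@fint L) e t)) A.
Proof.
elim: A w e => //=.
- by move=> r s w e _; rewrite !eval_tsubst.
- by move=> s w e _; rewrite eval_tsubst.
- by move=> B IHB C IHC w e [? ?]; rewrite IHB ?IHC.
- by move=> B IHB C IHC w e [? ?]; rewrite IHB ?IHC.
- by move=> B IHB C IHC w e [? ?]; apply: eq_forall => w'; rewrite IHB ?IHC.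
- move=> y B IH w e; rewrite mem_filter eq_sym.
  have [->|yx] /= := eqVneq y x => ff; apply: eq_forall => n.
    by rewrite upd_same.
  case: ff => [xB|[yt ff]].
    by rewrite subst_id // [in RHS]upd_swap ?(sat_upd_fresh _ _ _ xB) // eq_sym.
  rewrite IH // upd_swap //; congr (sat _ (upd (upd _ _ _) _ _) _).
  apply: eval_agree => z zt; rewrite /upd; case: eqP => // zy.
  by rewrite -zy zt in yt.
- move=> y B IH w e; rewrite mem_filter eq_sym.
  have [->|yx] /= := eqVneq y x => ff; apply: eq_exists => n.
    by rewrite upd_same.
  case: ff => [xB|[yt ff]].
    by rewrite subst_id // [in RHS]upd_swap ?(sat_upd_fresh _ _ _ xB) // eq_sym.
  rewrite IH // upd_swap //; congr (sat _ (upd (upd _ _ _) _ _) _).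
  apply: eval_agree => z zt; rewrite /upd; case: eqP => // zy.
  by rewrite -zy zt in yt.
Qed.

Lemma sat_subst_numeral A w e x n :
  sat w e (subst A x (numeral n)) = sat w (upd e x n) A.
Proof.
by rewrite sat_subst ?eval_numeral //; apply/free_for_closed/tvars_numeral.
Qed.

(** The induction is on a bound for the depth because instances of a quantified formula are not
    subformulas. The environment is the valuation built into [value], so open formulas are covered
    too. *)
Lemma gforces_sat w A : gforces w A = sat w (fun=> 0) A.
Proof.
move: (leqnn (depth A)); move: {2}(depth A) => d.
elim: d A w => [|d IH] [] //= => [B C|B C|B C|x B|x B];
  rewrite ltnS ?geq_max => w dA.
- case/andP: dA => dB dC; by rewrite gforces_And !IH.
- case/andP: dA => dB dC; rewrite gforces_Or propeqE; split => [[] wBC|[] wB].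
  + by left; rewrite -IH //; apply/wBC/le_refl.
  + by right; rewrite -IH //; apply/wBC/le_refl.
  + by left=> w' ww'; rewrite IH //; apply: sat_mono wB.
  + by right=> w' ww'; rewrite IH //; apply: sat_mono wB.
- case/andP: dA => dB dC; rewrite gforces_Imp; apply: eq_forall => w'.
  by rewrite !IH.
- rewrite gforces_All; apply: eq_forall => n.
  by rewrite IH ?depth_subst // sat_subst_numeral.
- rewrite gforces_Ex propeqE; split=> [/(_ w (le_refl w))[n]|[n wB] w' ww'].
    by rewrite IH ?depth_subst // sat_subst_numeral; exists n.
  exists n; rewrite IH ?depth_subst // sat_subst_numeral.
  exact: sat_mono wB.
Qed.

Lemma gforces_mono A w w' : le w w' -> gforces w A -> gforces w' A.
Proof. by rewrite !gforces_sat; apply: sat_mono. Qed.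

Lemma sat_Eq w e s t :
  sat w e (Eq s t) = (eval (@fint L) e s = eval (@fint L) e t).
Proof. by []. Qed.

Lemma sat_Imp w e A B :
  sat w e (Imp A B) = forall w', le w w' -> sat w' e A -> sat w' e B.
Proof. by []. Qed.

Lemma sat_HA_scheme B w e : HA_scheme B -> sat w e B.
Proof.
case=> {B}.
(* The schemes of arithmetic stay folded, so that [eval_tsucc] and its like still apply; goal 24 is
   induction. *)
1-16: rewrite /=.
24: rewrite /=.
- by move=> A B w1 _ wA w2 w12 _; apply: sat_mono wA.
- move=> A B C w1 _ wABC w2 w12 wAB w3 w23 wA.
  apply: (wABC w3) (le_refl _) _; [exact: le_trans w23|by []|].
  exact: wAB.
- by move=> A B w1 _ wA w2 w12 wB; split=> //; apply: sat_mono wA.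
- by move=> A B w1 _ [].
- by move=> A B w1 _ [].
- by left.
- by right.
- move=> A B C w1 _ wAC w2 w12 wBC w3 w23 [wA|wB]; last exact: wBC.
  by apply: wAC => //; apply: le_trans w23.
- by [].
- by move=> x A t tA w1 _ wA; rewrite sat_subst.
- by move=> x A B w1 _ wAB w2 w12 wA n; apply: wAB.
- by move=> x A xA w1 _ wA n; rewrite sat_upd_fresh.
- by move=> x A t tA w1 _; rewrite sat_subst // => wA; eexists; apply: wA.
- move=> x A B xB w1 _ wAB w2 w12 [n wA].
  by rewrite -(sat_upd_fresh _ _ n xB); apply: (wAB n).
- by [].
- by move=> x A s t sA tA w1 _ est w2 _; rewrite !sat_subst // est.
- by move=> t; rewrite /Neg sat_Imp => w1 _; rewrite sat_Eq eval_tsucc.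
- by move=> s t; rewrite sat_Imp => w1 _; rewrite !sat_Eq !eval_tsucc => -[].
- by move=> s; rewrite sat_Eq eval_tadd addn0.
- by move=> s t; rewrite sat_Eq eval_tsucc !eval_tadd eval_tsucc addnS.
- by move=> s; rewrite sat_Eq eval_tmul muln0.
- by move=> s t; rewrite sat_Eq eval_tadd !eval_tmul eval_tsucc mulnS addnC.
- by move=> f i lti; apply: fintP.
(* [tzero] is [numeral 0]. As quantifiers range over omega at every world, the scheme reduces to
   induction on [n] at the fixed world [w2]. *)
- move=> x A w1 _; rewrite (sat_subst_numeral A _ _ _ 0) => wA0 w2 w12 wAS.
  elim=> [|n IHn]; first exact: sat_mono wA0.
  have := wAS n w2 (le_refl _) IHn.
  rewrite sat_subst; last by apply: free_for_self; rewrite tvars_tsucc.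
  by rewrite eval_tsucc upd_same /= /upd eqxx.
Qed.

Lemma sat_HAT_axiom A w e : HAT_axiom A -> sat w e A.
Proof.
case=> xs [B [axB -> _]]; elim: xs e => [|x xs IH] e /=.
  exact: sat_HA_scheme.
by move=> n; apply: IH.
Qed.

Lemma sat_HA_provable A w e : HA_provable A -> sat w e A.
Proof.
move=> prA; elim: prA w => {A} [A /sat_HAT_axiom //|A B _ IHAB _ IHA] w.
exact: IHAB (le_refl w) (IHA w).
Qed.

End Forcing.

(** * Extensions, gluing and compositional supervaluation *)

(** The back condition returns to [M] the worlds over which an implication quantifies; all other
    clauses of [sat] stay at one world. It serves for the inclusion of a component into the
    amalgam. *)
Lemma sat_bounded_morphism (L : prlang) (M K : structure L) (g : M -> K) :
  (forall x y, le x y -> le (g x) (g y)) ->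
  (forall x b, le (g x) b -> exists2 y, b = g y & le x y) ->
  (forall x, interp (g x) = interp x) ->
  forall A w e, sat (g w) e A = sat w e A.
Proof.
move=> forth back eqI; elim=> //=.
- by move=> s w e; rewrite eqI.
- by move=> B IHB C IHC w e; rewrite IHB IHC.
- by move=> B IHB C IHC w e; rewrite IHB IHC.
- move=> B IHB C IHC w e; rewrite propeqE; split=> BC v wv vB.
    by rewrite -IHC; apply: BC; [apply: forth|rewrite IHB].
  by have [y vy wy] := back _ _ wv; subst v; rewrite IHC; apply: BC;
    rewrite // -IHB.
- by move=> x B IH w e; apply: eq_forall => n; apply: IH.
- by move=> x B IH w e; apply: eq_exists => n; apply: IH.
Qed.

Lemma embedding_id (L : prlang) (M : structure L) : embedding (@id M).
Proof. by split=> [u v|u v|w n]. Qed.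

(* The disjoint union of M and the N_i, in which moreover a world u of M lies
   below all the worlds of N_i above f_i u. *)
Section Amalgam.
Variables (L : prlang) (M : structure L) (I : Type) (N : I -> structure L).
Variable f : forall i, M -> N i.
Hypothesis embf : forall i, embedding (f i).

Definition amalgam_world : Type := (M + {i : I & N i})%type.

(** Worlds of different components have different types, so they are compared after transport along
    an equality of tags. *)
Definition amalgam_le (a b : amalgam_world) : Prop :=
  match a, b with
  | inl u, inl v => le u v
  | inl u, inr y => le (f (tag y) u) (tagged y)
  | inr _, inl _ => False
  | inr x, inr y =>
      exists e : tag x = tag y, le (eq_rect _ N (tagged x) _ e) (tagged y)
  end.

Definition amalgam_interp (a : amalgam_world) : set nat :=
  match a with inl u => interp u | inr x => interp (tagged x) end.

Lemma amalgam_le_refl a : amalgam_le a a.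
Proof.
by case: a => [u|x] /=; [|exists erefl]; apply: le_refl.
Qed.

Lemma amalgam_le_trans a b c :
  amalgam_le a b -> amalgam_le b c -> amalgam_le a c.
Proof.
case: a b c => [u|[i x]] [v|[j y]] [z|[k z]] //=.
- exact: le_trans.
- by move=> uv; apply: le_trans; have [_ lef _] := embf k; rewrite -lef.
- by move=> uy [e]; subst k => /=; apply: le_trans.
- move=> [e]; subst j => /= xy [e]; subst k => /= yz.
  by exists erefl; apply: le_trans yz.
Qed.

Lemma amalgam_le_anti a b : amalgam_le a b -> amalgam_le b a -> a = b.
Proof.
case: a b => [u|[i x]] [v|[j y]] //=.
- by move=> uv vu; rewrite (le_anti uv vu).
(* Each inequality brings its own equality proof; by proof irrelevance the second one is reflexivity
   and its transport vanishes. *)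
- move=> [e]; subst j => /= xy [e]; rewrite (Prop_irrelevance e erefl) /= => yx.
  by rewrite (le_anti xy yx).
Qed.

Lemma amalgam_interp_sent a : (amalgam_interp a `<=` SENT L)%classic.
Proof. by case: a => ?; apply: interp_sent. Qed.

Lemma amalgam_interp_mono a b :
  amalgam_le a b -> (amalgam_interp a `<=` amalgam_interp b)%classic.
Proof.
case: a b => [u|[i x]] [v|[j y]] //=.
- exact: interp_mono.
- by move=> /interp_mono uy n un; apply: uy; have [_ _] := embf j; apply.
- by move=> [e]; subst j; apply: interp_mono.
Qed.

Definition amalgam : structure L :=
  @Structure L amalgam_world amalgam_le amalgam_le_refl amalgam_le_trans
    amalgam_le_anti amalgam_interp amalgam_interp_sent amalgam_interp_mono.

Lemma embedding_amalgam : embedding (inl : M -> amalgam).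
Proof. by split=> [u v []|u v|w n]. Qed.

(** By persistence, what is forced at [inl w] is forced at the copy of [f i w] above it; the copy of
    [N i] is closed upwards, so forcing there is as in [N i]. *)
Lemma gforces_amalgam i w A :
  gforces (inl w : amalgam) A -> gforces (f i w) A.
Proof.
move=> wA; have {wA} : gforces (inr (Tagged N (f i w)) : amalgam) A.
  by apply: gforces_mono wA => /=; apply: le_refl.
rewrite !gforces_sat.
rewrite (@sat_bounded_morphism _ _ amalgam (fun x : N i => inr (Tagged N x))) //=.
- by move=> x y xy; exists erefl.
- by move=> x [//|[j y]] /= [e]; subst j => xy; exists y.
Qed.

End Amalgam.

(** One refuting extension is chosen for each index; by [gforces_amalgam], none of the formulas is
    forced at the copy of [w] in their amalgam. *)
Lemma common_countermodel (L : prlang) (M : structure L) (w : M) (I : Type)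
    (A : I -> form L) :
  (forall i, ~ forall (N : structure L) (f : M -> N),
     embedding f -> gforces (f w) (A i)) ->
  exists (K : structure L) (g : M -> K),
    embedding g /\ forall i, ~ gforces (g w) (A i).
Proof.
move=> notA.
have /choice[F FP] i : exists F : {N : structure L & M -> N},
    embedding (projT2 F) /\ ~ gforces (projT2 F w) (A i).
  apply: contrapT => noF; apply: (notA i) => N f embf.
  apply: contrapT => nA; apply: noF; by exists (existT _ N f).
pose N i := projT1 (F i); pose f i : M -> N i := projT2 (F i).
have embf i : embedding (f i) by have [] := FP i.
exists (amalgam embf), inl; split; first exact: embedding_amalgam.
by move=> i wA; have [_] := FP i; apply; apply: (gforces_amalgam (embf := embf)).
Qed.

(** For [Imp] this is the defining clause. For [Or] and [Ex], from right to left,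
    [common_countermodel] merges separate refutations of the disjuncts or instances into one
    refutation of the whole. *)
Lemma csvE (L : prlang) (M : structure L) (w : M) (A : form L) :
  csv w A = forall (N : structure L) (f : M -> N),
    embedding f -> gforces (f w) A.
Proof.
(* Embeddings preserve the order, so truth in all extensions is persistent. *)
have lift A' (u v : M) : le u v ->
    (forall (N : structure L) (f : M -> N), embedding f -> gforces (f u) A') ->
    forall (N : structure L) (f : M -> N), embedding f -> gforces (f v) A'.
  move=> uv uA N f embf; apply: gforces_mono (uA N f embf).
  by have [_ <- _] := embf.
move: (ltnSn (depth A)); move: {2}(depth A).+1 => d.
elim: d A w => [|d IH] [|s t|s|B C|B C|B C|x B|x B] // w dA.
- by rewrite propeqE; split=> [//|]; apply; apply: embedding_id.
- by rewrite propeqE; split=> [//|]; apply; apply: embedding_id.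
- rewrite propeqE; split=> [wA N f [_ _ If]|]; first exact: If.
  by apply; apply: embedding_id.
- move: dA; rewrite /= ltnS gtn_max => /andP[dB dC].
  rewrite csv_And !IH // propeqE; split=> [[wB wC] N f embf|wBC].
    by rewrite gforces_And; split; [apply: wB|apply: wC].
  by split=> N f /wBC; rewrite gforces_And => -[].
- move: dA; rewrite /= ltnS gtn_max => /andP[dB dC].
  rewrite csv_Or propeqE; split=> [wBC N f embf|wBC].
    rewrite gforces_sat /=; case: wBC => /(_ w (le_refl w));
      by rewrite IH // => /(_ N f embf); rewrite gforces_sat; auto.
  apply: contrapT => /not_orP[nB nC].
  have [|K [g [embg ng]]] :=
      @common_countermodel L M w bool (fun b => if b then B else C).
    case=> wA; [apply: nB|apply: nC] => v wv; rewrite IH //; exact: lift wA.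
  have := wBC K g embg; rewrite gforces_sat /= -!gforces_sat.
  by case; [apply: (ng true)|apply: (ng false)].
- move: dA; rewrite /= ltnS => dB.
  rewrite csv_All propeqE; split=> [wB N f embf|wB n].
    by rewrite gforces_All => n; have := wB n; rewrite IH ?depth_subst //; apply.
  by rewrite IH ?depth_subst // => N f /wB; rewrite gforces_All.
- move: dA; rewrite /= ltnS => dB.
  rewrite csv_Ex propeqE; split=> [wB N f embf|wB].
    have [n] := wB w (le_refl w); rewrite IH ?depth_subst // => wBn.
    rewrite gforces_Ex => w' ww'; exists n.
    exact: gforces_mono ww' (wBn N f embf).
  (* A single [n] serves all extensions: otherwise countermodels to all the instances glue into one
     that refutes [Ex x B]. By [lift], the same [n] serves the later worlds. *)
  have [n wBn] : exists n, forall (N : structure L) (f : M -> N),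
      embedding f -> gforces (f w) (subst B x (numeral n)).
    apply: contrapT => /forallNP nB.
    have [K [g [embg ng]]] := common_countermodel nB.
    have := wB K g embg; rewrite gforces_Ex => /(_ _ (le_refl _))[n].
    exact: ng.
  by move=> w' ww'; exists n; rewrite IH ?depth_subst //; apply: lift wBn.
Qed.

(** * One-world structures *)

Section Point.
Variables (L : prlang) (X : set nat).
Hypothesis sentX : (X `<=` SENT L)%classic.

Definition point : structure L :=
  @Structure L unit (fun _ _ => True) (fun=> I) (fun _ _ _ _ _ => I)
    (fun u v _ _ => match u, v with tt, tt => erefl end)
    (fun=> X) (fun=> sentX) (fun _ _ _ _ xX => xX).

(** By [csvE]: the embeddings of [point] are exactly the maps to a world whose interpretation
    includes [X]. *)
Lemma csv_point A :
  csv (tt : point) A =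
  forall (M : structure L) (w : M), (X `<=` interp w)%classic -> gforces w A.
Proof.
rewrite csvE propeqE; split=> [ptA M w Xw|supA M f [_ _ If]]; last first.
  exact: (supA _ _ (If tt)).
apply: (ptA M (fun=> w)); split=> [[] []|u v|u] //.
by split=> // _; apply: le_refl.
Qed.

End Point.

(** * Injectivity of coding, and decoding of compound sentences *)

Lemma code_seq_inj : injective CodeSeq.code.
Proof. exact: can_inj CodeSeq.codeK. Qed.

Lemma code_fsym_inj (S : sig) : injective (@code_fsym S).
Proof.
move=> [||||i] [||||j] //=; rewrite !addSn !add0n => -[] ij.
by congr Ext; apply: val_inj.
Qed.

Lemma code_term_inj (S : sig) : injective (@code_term S).
Proof.
elim=> [x|f ts IH] [y|g us] /code_seq_inj //; first by case=> ->.
case=> /code_fsym_inj fg; subst g => /eq_in_map eq_ts; congr Fn.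
by apply: funext => i; apply/IH/eq_ts; rewrite mem_enum.
Qed.

Lemma code_inj (S : sig) : injective (@code S).
Proof.
elim=> [|s t|s|B IHB C IHC|B IHB C IHC|B IHB C IHC|x B IH|x B IH];
  case=> [|s' t'|s'|B' C'|B' C'|B' C'|y B'|y B'] /code_seq_inj //.
- by case=> /code_term_inj -> /code_term_inj ->.
- by case=> /code_term_inj ->.
1-3: by case=> /IHB -> /IHC ->.
(* Positions 1 and 2 of the coded list hold the variable and the body. *)
1-2: move=> E; have eq_x : code_term (@Var S x) = code_term (@Var S y)
       := congr1 (nth 0 ^~ 1) E.
1-2: by have /IH -> : code B = code B' := congr1 (nth 0 ^~ 2) E;
  case/code_term_inj: eq_x => ->.
Qed.

Lemma sentence_cat (S : sig) (B C : form S) :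
  fv B ++ fv C = [::] -> sentence B /\ sentence C.
Proof. by rewrite /sentence; case: (fv B). Qed.

Lemma fv_body (S : sig) (B : form S) y :
  [seq z <- fv B | z != y] = [::] -> {subset fv B <= [:: y]}.
Proof.
move=> noB z zB; rewrite inE; apply/idPn => zy.
by have : z \in [seq z <- fv B | z != y] by [rewrite mem_filter zy]; rewrite noB.
Qed.

(** The axioms quantify over arbitrary numbers guarded by [Sent]; this and the next four lemmas
    recover formulas from the guard. The tags of the coded lists rule out the other constructors. *)
Lemma SENT_or (S : sig) n m : SENT S (code_or n m) ->
  exists B C : form S, [/\ sentence B, sentence C, n = code B & m = code C].
Proof.
case=> [[|s t|s|B C|B C|B C|x B|x B]] [sA /code_seq_inj] // [-> ->].
by have [] := sentence_cat sA; exists B, C.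
Qed.

Lemma SENT_and (S : sig) n m : SENT S (code_and n m) ->
  exists B C : form S, [/\ sentence B, sentence C, n = code B & m = code C].
Proof.
case=> [[|s t|s|B C|B C|B C|x B|x B]] [sA /code_seq_inj] // [-> ->].
by have [] := sentence_cat sA; exists B, C.
Qed.

Lemma SENT_imp (S : sig) n m : SENT S (code_imp n m) ->
  exists B C : form S, [/\ sentence B, sentence C, n = code B & m = code C].
Proof.
case=> [[|s t|s|B C|B C|B C|x B|x B]] [sA /code_seq_inj] // [-> ->].
by have [] := sentence_cat sA; exists B, C.
Qed.

Lemma SENT_ex (S : sig) n m : SENT S (code_ex n m) ->
  exists y (B : form S),
    [/\ {subset fv B <= [:: y]}, n = code_term (@Var S y) & m = code B].
Proof.
case=> [[|s t|s|B C|B C|B C|x B|x B]] [sA /code_seq_inj] // [-> ->].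
by exists x, B; split=> //; apply: fv_body.
Qed.

Lemma SENT_all (S : sig) n m : SENT S (code_all n m) ->
  exists y (B : form S),
    [/\ {subset fv B <= [:: y]}, n = code_term (@Var S y) & m = code B].
Proof.
case=> [[|s t|s|B C|B C|B C|x B|x B]] [sA /code_seq_inj] // [-> ->].
by exists x, B; split=> //; apply: fv_body.
Qed.

(** * Membership in a fixed point *)

Section FixedPoint.
Variables (L : prlang) (M : structure L).
Hypothesis fixM : fixed_point_model M.
Implicit Types (w : M) (A B C : form L).

(** From left to right, [J_csv] is instantiated with the point. Conversely, truth at the point is
    truth at every world with a larger interpretation, and embeddings only enlarge
    interpretations. *)
Lemma interp_csv w A : sentence A ->
  interp w (code A) <-> csv (tt : point (@interp_sent L M w)) A.
Proof.
move=> sA; split=> [wA|ptA].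
  have [B [_ /code_inj <- csvA]] : J_csv L (interp w) (code A) by rewrite -fixM.
  exact: csvA.
rewrite fixM; exists A; split=> // N v Iv; rewrite csvE => K f [_ _ If].
by move: ptA; rewrite csv_point; apply; rewrite -Iv; apply: If.
Qed.

Lemma interp_code w A : sentence A ->
  interp w (code A) <->
  forall (N : structure L) (v : N),
    (interp w `<=` interp v)%classic -> gforces v A.
Proof. by move=> sA; rewrite interp_csv // csv_point. Qed.

(** [w] is itself one of the worlds whose interpretation includes [interp w]. *)
Lemma interp_gforces w A : sentence A -> interp w (code A) -> gforces w A.
Proof. by move=> sA /interp_code; apply. Qed.

(** At the point, which has a single world, the global clause for [Or] is the local one. *)
Lemma interp_Or w B C : sentence B -> sentence C ->
  interp w (code_or (code B) (code C)) <->
  interp w (code B) \/ interp w (code C).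
Proof.
move=> sB sC; rewrite -/(code (Or B C)) !interp_csv //; last first.
  by rewrite /sentence /= sB sC.
rewrite csv_Or; split=> [[wB|wC]|[wB|wC]].
- by left; apply: wB.
- by right; apply: wC.
- by left; case.
- by right; case.
Qed.

Lemma interp_And w B C : sentence B -> sentence C ->
  interp w (code_and (code B) (code C)) <->
  interp w (code B) /\ interp w (code C).
Proof.
move=> sB sC; rewrite -/(code (And B C)) !interp_csv ?csv_And //.
by rewrite /sentence /= sB sC.
Qed.

Lemma interp_Imp w B C : sentence B -> sentence C ->
  interp w (code_imp (code B) (code C)) -> interp w (code B) ->
  interp w (code C).
Proof.
move=> sB sC; rewrite -/(code (Imp B C)) !interp_code //; last first.
  by rewrite /sentence /= sB sC.
move=> wBC wB N v Iv; have := wBC N v Iv; rewrite gforces_Imp; apply.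
  exact: le_refl.
exact: wB.
Qed.

(** Links the axioms, which speak of closed terms, to the quantifier clauses, which speak of
    numerals. *)
Lemma gforces_subst (N : structure L) (v : N) B y t : tclosed t ->
  gforces v (subst B y t) = gforces v (subst B y (numeral (value t))).
Proof.
move=> ct; rewrite !gforces_sat sat_subst_numeral sat_subst //.
exact: free_for_closed.
Qed.

(** The single world of the point yields a numeral as witness; conversely, [value t] is a witness at
    all worlds with a larger interpretation. *)
Lemma interp_Ex w B y : {subset fv B <= [:: y]} ->
  interp w (code_ex (code_term (@Var L y)) (code B)) <->
  exists2 t : term L, tclosed t & interp w (code (subst B y t)).
Proof.
move=> fvB; rewrite -/(code (Ex y B)).
have sE : sentence (Ex y B).
  rewrite /sentence /= -(filter_pred0 (fv B)); apply: eq_in_filter => z /fvB.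
  by rewrite inE => /eqP ->; rewrite eqxx.
split=> [|[t ct wt]].
  rewrite interp_csv // csv_Ex => /(_ tt I)[n wn].
  exists (numeral n); first exact: tvars_numeral.
  apply/interp_csv => //.
  by apply: sentence_subst => //; apply: tvars_numeral.
apply/interp_code => // N v Iv; rewrite gforces_Ex => v' vv'; exists (value t).
rewrite -gforces_subst //.
have sB : sentence (subst B y t) by exact: sentence_subst.
by apply: (proj1 (interp_code w sB) wt) => n /Iv; apply: interp_mono.
Qed.

Lemma interp_All w B y : {subset fv B <= [:: y]} ->
  interp w (code_all (code_term (@Var L y)) (code B)) <->
  forall t : term L, tclosed t -> interp w (code (subst B y t)).
Proof.
move=> fvB; rewrite -/(code (All y B)).
have sE : sentence (All y B).
  rewrite /sentence /= -(filter_pred0 (fv B)); apply: eq_in_filter => z /fvB.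
  by rewrite inE => /eqP ->; rewrite eqxx.
rewrite interp_code //; split=> [wB t ct|wB N v Iv].
  apply/interp_code => [|N v /wB]; first exact: sentence_subst.
  by rewrite gforces_All gforces_subst.
rewrite gforces_All => n; have cn : tclosed (@numeral L n) by exact: tvars_numeral.
have sB : sentence (subst B y (numeral n)) by exact: sentence_subst.
exact: (proj1 (interp_code w sB) (wB _ cn)).
Qed.

End FixedPoint.

(** * Representing formulas and dotted syntax *)

Section Representation.
Variables (L : prlang) (M : structure L).
Implicit Types (w : M) (e : nat -> nat) (P : form L).

(** By soundness, the provable instances, positive or negative, hold at every world; a case
    distinction on [X] gives the equivalence. *)
Lemma sat_represents1 P X w e t : represents1 P X -> free_for t 0 P ->
  sat w e (subst P 0 t) <-> X (eval (@fint L) e t).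
Proof.
case=> _ fvP pos neg tP; rewrite sat_subst // -sat_subst_numeral.
split=> [wP|/pos prP]; last exact: sat_HA_provable.
apply: contrapT => /neg nP; exact: (sat_HA_provable w e nP) (le_refl w) wP.
Qed.

(** [s != 1] keeps the second substitution from replacing the variable put in by the first; the
    conditions on [bvars P] exclude capture. *)
Lemma sat_represents2 P R w e s y : represents2 P R ->
  s != 1 -> s \notin bvars P -> y \notin bvars P ->
  sat w e (subst (subst P 0 (Var s)) 1 (Var y)) <-> R (e s) (e y).
Proof.
case=> _ fvP pos neg s1 sP yP.
have ff x z A : z \notin bvars A -> free_for (@Var L z) x A.
  by move=> zA; apply: free_for_bvars => u; rewrite inE => /eqP ->.
have -> : sat w e (subst (subst P 0 (Var s)) 1 (Var y)) =
    sat w e (subst (subst P 0 (numeral (e s))) 1 (numeral (e y))).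
  rewrite sat_subst; last by apply: ff; rewrite bvars_subst.
  rewrite sat_subst; last exact: ff.
  rewrite !sat_subst_numeral; congr (sat _ (upd _ _ _) _).
  by rewrite /= /upd (negbTE s1).
split=> [wP|/pos prP]; last exact: sat_HA_provable.
apply: contrapT => /neg nP; exact: (sat_HA_provable w e nP) (le_refl w) wP.
Qed.

End Representation.

Lemma eval_op1 (L : prlang) (f : 'I_(nsym L)) g e t : is_op1 f g ->
  eval (@fint L) e (op1 f t) = g (eval (@fint L) e t).
Proof. by case=> ar fg; rewrite eval_App_Ext ?ar //= fg. Qed.

Lemma eval_op2 (L : prlang) (f : 'I_(nsym L)) g e s t : is_op2 f g ->
  eval (@fint L) e (op2 f s t) = g (eval (@fint L) e s) (eval (@fint L) e t).
Proof. by case=> ar fg; rewrite eval_App_Ext ?ar //= fg. Qed.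

Lemma tvars_op2 (L : prlang) (f : 'I_(nsym L)) g s t : is_op2 f g ->
  tvars (op2 f s t) = tvars s ++ tvars t.
Proof.
by case=> ar _; rewrite /= (map_enum_nth (@tvars L)) ?ar //= cats0.
Qed.

Section DottedSyntax.
Variables (L : prlang) (D : syntax L) (M : structure L).
Implicit Types (w : M) (e : nat -> nat) (A B : form L).

Lemma var_inj i j : (var D i == var D j) = (i == j).
Proof. exact: eqn_add2r. Qed.

Lemma upd_var e i j n :
  upd e (var D i) n (var D j) = if j == i then n else e (var D j).
Proof. by rewrite /upd var_inj. Qed.

Lemma eval_upd_var fi e i j n :
  eval fi (upd e (var D i) n) (@Var L (var D j)) =
  if j == i then n else eval fi e (@Var L (var D j)).
Proof. exact: upd_var. Qed.

Lemma fvars_lt_var i y :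
  y \in 1 :: fvars (f_sent D) ++ fvars (f_cterm D) ++ fvars (f_val D) ++
        fvars (f_axhat D) ->
  y < var D i.
Proof.
by move=> yD; rewrite /var addnS ltnS (leq_trans _ (leq_addl _ _)) //
  (leq_bigmax_seq y).
Qed.

Lemma var_fresh i : [/\ var D i != 1, var D i \notin bvars (f_sent D),
  var D i \notin bvars (f_cterm D), var D i \notin bvars (f_val D) &
  var D i \notin bvars (f_axhat D)].
Proof.
have nin : var D i \notin 1 :: fvars (f_sent D) ++ fvars (f_cterm D) ++
    fvars (f_val D) ++ fvars (f_axhat D).
  by apply/negP => /fvars_lt_var - /(_ i); rewrite ltnn.
move: nin; rewrite inE !mem_cat !negb_or => /and5P[-> ? ? ? ?].
by split=> //; apply: contra (@bvars_fvars _ _ _) _.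
Qed.

Lemma sat_Iff w e A B :
  (forall w', le w w' -> sat w' e A <-> sat w' e B) -> sat w e (Iff A B).
Proof. by move=> AB; split=> w' /AB[]. Qed.

Lemma sat_All w e x A :
  sat w e (All x A) = forall n, sat w (upd e x n) A.
Proof. by []. Qed.

Lemma sat_Tr w e t : sat w e (Tr t) = interp w (eval (@fint L) e t).
Proof. by []. Qed.

Lemma free_for_Var x z A : z \notin bvars A -> free_for (@Var L z) x A.
Proof. by move=> zA; apply: free_for_bvars => u; rewrite inE => /eqP ->. Qed.

Lemma sat_Sent_Var w e i : sat w e (Sent D (Var (var D i))) <->
  SENT L (e (var D i)).
Proof.
apply: (sat_represents1 w e (f_sentP D)).
by apply: free_for_Var; case: (var_fresh i).
Qed.

Lemma sat_Sent_op2 w e f g i j : is_op2 f g ->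
  sat w e (Sent D (op2 f (Var (var D i)) (Var (var D j)))) <->
  SENT L (g (e (var D i)) (e (var D j))).
Proof.
move=> fg; rewrite -(eval_op2 e (Var (var D i)) (Var (var D j)) fg).
apply: (sat_represents1 w e (f_sentP D)); apply: free_for_bvars => y.
by rewrite (tvars_op2 _ _ fg) !inE => /orP[] /eqP ->;
  [case: (var_fresh i)|case: (var_fresh j)].
Qed.

Lemma sat_AxHAT w e i :
  sat w e (AxHAT D (Var (var D i))) <-> AX_HAT L (e (var D i)).
Proof.
apply: (sat_represents1 w e (f_axhatP D)).
by apply: free_for_Var; case: (var_fresh i).
Qed.

Lemma sat_cterm w e i :
  sat w e (subst (f_cterm D) 0 (Var (var D i))) <-> CTERM L (e (var D i)).
Proof.
apply: (sat_represents1 w e (f_ctermP D)).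
by apply: free_for_Var; case: (var_fresh i).
Qed.

(** The guard is an implication and so looks at later worlds; persistence brings the claim back to
    [w]. *)
Lemma sat_AllT w e i A : sat w e (AllT D (var D i) A) <->
  forall t : term L, tclosed t -> sat w (upd e (var D i) (code_term t)) A.
Proof.
rewrite sat_All; split=> [wA t ct|wA n].
  apply: (wA _ w (le_refl w)); apply/sat_cterm.
  by rewrite upd_var eqxx; exists t.
rewrite sat_Imp => w' ww' /sat_cterm; rewrite upd_var eqxx => -[t [ct ->]].
exact: sat_mono ww' (wA t ct).
Qed.

Lemma sat_ExT w e i A : sat w e (ExT D (var D i) A) <->
  exists2 t : term L, tclosed t & sat w (upd e (var D i) (code_term t)) A.
Proof.
split=> [[n [/sat_cterm]]|[t ct wA]].
  by rewrite upd_var eqxx => -[t [ct ->]] wA; exists t.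
exists (code_term t); split=> //; apply/sat_cterm.
by rewrite upd_var eqxx; exists t.
Qed.

(** The existential witness can only be [value t], because a code determines its term. *)
Lemma sat_atValue w e i j A (t : term L) : i != j ->
  tclosed t -> e (var D i) = code_term t ->
  sat w e (atValue D (Var (var D i)) (var D j) A) <->
  sat w (upd e (var D j) (value t)) A.
Proof.
move=> ij ct eit.
have valP n : sat w (upd e (var D j) n)
    (subst (subst (f_val D) 0 (Var (var D i))) 1 (Var (var D j))) <->
    n = value t.
  have [i1 _ _ iv _] := var_fresh i; have [_ _ _ jv _] := var_fresh j.
  rewrite (sat_represents2 _ _ (f_valP D)) // !upd_var eqxx (negbTE ij) eit.
  split=> [[u [_ /code_term_inj <-]] //|->]; by exists t.
split=> [[n [/valP ->]] //|wA]; exists (value t); split=> //; exact/valP.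
Qed.

End DottedSyntax.

Lemma eval_quote (L : prlang) e (A : form L) :
  eval (@fint L) e (quote A) = code A.
Proof. exact: eval_numeral. Qed.

Lemma eval_d_subst (L : prlang) (D : syntax L) e x t v :
  eval (@fint L) e (d_subst D x t v) = fint (d_sub D)
    [:: eval (@fint L) e x; eval (@fint L) e t; eval (@fint L) e v].
Proof. by have [ar _] := d_subP D; rewrite eval_App_Ext ?ar. Qed.

(** * Verification of the axioms *)

Theorem theorem5 (L : prlang) (D : syntax L) (M : structure L)
    (fixM : fixed_point_model M) (A : form L) (axA : CSV_axiom D A) :
  gvalid M A.
Proof.
move=> w; rewrite gforces_sat; case: axA => {A}.
- move=> s t y z eq_st val_eq_st; apply/sat_AllT => a ca; apply/sat_AllT => b cb.
  set e := upd _ _ _.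
  have eq_stE : eval (@fint L) e eq_st = code (Eq a b).
    by rewrite (eval_op2 _ _ _ (d_eqP D)) /= /e !upd_var.
  have sent_ab : sentence (Eq a b) by rewrite /sentence /= ca cb.
  have val_eq_stE (w' : M) : sat w' e val_eq_st <-> value a = value b.
    rewrite (@sat_atValue _ _ _ _ _ _ _ _ a) // /e ?upd_var //.
    rewrite (@sat_atValue _ _ _ _ _ _ _ _ b) // ?upd_var //.
    by rewrite sat_Eq /= !upd_var.
  split; apply: sat_Iff => w1 _.
    rewrite val_eq_stE sat_Tr eq_stE; split=> [|ab].
      exact: (interp_gforces fixM sent_ab).
    by apply/(interp_code fixM) => // N v _; rewrite gforces_Eq.
  rewrite sat_Tr (eval_op2 _ _ _ (d_impP D)) eq_stE eval_quote.
  have sent_nab : sentence (Neg (Eq a b)) by rewrite /sentence /= ca cb.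
  split=> [|nab].
    move/(interp_gforces fixM sent_nab); rewrite gforces_Imp => wnab w2 w12.
    by move/val_eq_stE => ab; case: (wnab w2 w12 ab).
  apply: (proj2 (interp_code fixM w1 sent_nab)) => N v _.
  rewrite gforces_Imp => v' _ ab.
  (* The equation of values does not depend on the world, so it passes from [v'] in [N] to [w1] in
     [M]. *)
  exact: (nab w1 (le_refl w1) (proj2 (val_eq_stE w1) ab)).
- move=> x y x_or_y; rewrite !sat_All => n; rewrite sat_All => m.
  rewrite sat_Imp => w1 _ /(sat_Sent_op2 _ _ _ _ _ (d_orP D)).
  rewrite !upd_var -[X in SENT _ X]/(code_or n m)
    => /SENT_or[B [C [sB sC -> ->]]].
  apply: sat_Iff => w2 _.
  rewrite sat_Tr (eval_op2 _ _ _ (d_orP D)) /= !upd_var /=.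
  exact: interp_Or.
- move=> x y x_and_y; rewrite !sat_All => n; rewrite sat_All => m.
  rewrite sat_Imp => w1 _ /(sat_Sent_op2 _ _ _ _ _ (d_andP D)).
  rewrite !upd_var -[X in SENT _ X]/(code_and n m)
    => /SENT_and[B [C [sB sC -> ->]]].
  apply: sat_Iff => w2 _.
  rewrite sat_Tr (eval_op2 _ _ _ (d_andP D)) /= !upd_var /=.
  exact: interp_And.
- move=> x v t ex_vx; rewrite !sat_All => n; rewrite sat_All => m.
  rewrite sat_Imp => w1 _ /(sat_Sent_op2 _ _ _ _ _ (d_exP D)).
  (* [x] is quantified before [v]: [m] is the code of the variable and [n] that of the body. *)
  rewrite !upd_var -[X in SENT _ X]/(code_ex m n)
    => /SENT_ex[y [B [fvB -> ->]]].
  apply: sat_Iff => w2 _.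
  rewrite sat_Tr (eval_op2 _ _ _ (d_exP D)) !eval_upd_var.
  have [_ subP] := d_subP D; apply: (iff_trans (interp_Ex fixM w2 fvB)).
  split=> [[a ca wa]|/sat_ExT[a ca]].
    apply/sat_ExT; exists a => //.
    by rewrite sat_Tr eval_d_subst /= !upd_var /= subP.
  by rewrite sat_Tr eval_d_subst /= !upd_var /= subP // => wa; exists a.
- move=> x v t all_vx; rewrite !sat_All => n; rewrite sat_All => m.
  rewrite sat_Imp => w1 _ /(sat_Sent_op2 _ _ _ _ _ (d_allP D)).
  rewrite !upd_var -[X in SENT _ X]/(code_all m n)
    => /SENT_all[y [B [fvB -> ->]]].
  apply: sat_Iff => w2 _.
  rewrite sat_Tr (eval_op2 _ _ _ (d_allP D)) !eval_upd_var.
  have [_ subP] := d_subP D; apply: (iff_trans (interp_All fixM w2 fvB)).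
  split=> [wa|/sat_AllT wa].
    apply/sat_AllT => a ca.
    by rewrite sat_Tr eval_d_subst /= !upd_var /= subP //; apply: wa.
  move=> a ca; have := wa a ca.
  by rewrite sat_Tr eval_d_subst /= !upd_var /= subP.
- move=> x y x_imp_y; rewrite !sat_All => n; rewrite sat_All => m.
  rewrite sat_Imp => w1 _ /(sat_Sent_op2 _ _ _ _ _ (d_impP D)).
  rewrite !upd_var -[X in SENT _ X]/(code_imp n m)
    => /SENT_imp[B [C [sB sC -> ->]]].
  rewrite sat_Imp => w2 _.
  rewrite sat_Tr (eval_op2 _ _ _ (d_impP D)) /= !upd_var /=.
  by move=> wBC w3 w23; apply: interp_Imp => //; apply: interp_mono w23 _ wBC.
- move=> t y; apply/sat_AllT => a ca; apply: sat_Iff => w1 _.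
  rewrite (@sat_atValue _ _ _ _ _ _ _ _ a) // ?upd_var //.
  rewrite !sat_Tr (eval_op1 _ _ (d_trP D)) /= !upd_var /=.
  rewrite -/(code (Tr a)) (interp_code fixM) //.
  (* From right to left, the world is [w1] itself. *)
  by split=> [wa N v|]; [apply|apply].
- move=> x; rewrite sat_All => n; rewrite sat_Imp => w1 _ /sat_AxHAT.
  rewrite sat_Tr /= upd_var => -[B [axB ->]].
  apply/(interp_code fixM) => [|N v _]; first by case: axB => ? [? []].
  (* Soundness holds in every structure, hence at all worlds including [interp w1]. *)
  by rewrite gforces_sat; apply: sat_HAT_axiom.
- move=> x; rewrite sat_All => n; rewrite sat_Imp => w1 _ [].
  rewrite (eval_op2 _ _ _ (d_impP D)) eval_quote /= upd_var /=.
  (* Interpretations contain only codes of sentences, so [n] decodes to some [B]; then [B] and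
     [Neg B] would both be forced at [w1]. *)
  move=> wn; have [B [sB nB]] := interp_sent wn; move: wn; rewrite nB => wB.
  have sNB : sentence (Neg B) by rewrite /sentence /= sB.
  rewrite -/(code (Neg B)) => /(interp_gforces fixM sNB).
  rewrite gforces_Imp => /(_ w1 (le_refl w1)); apply.
  exact: (interp_gforces fixM).
- move=> x v; rewrite sat_All => n.
  have [_ subP] := d_subP D.
  have numE : eval (@fint L) (upd (fun=> 0) x n) (op1 (d_num D) (Var x)) =
      code_term (@numeral L n) by rewrite (eval_op1 _ _ (d_numP D)) eval_upd_var.
  rewrite sat_Tr eval_d_subst eval_quote numE eval_numeral.
  rewrite subP; last exact: tvars_numeral.
  apply/(interp_code fixM) => [|N u _].
    apply: sentence_subst; last exact: tvars_numeral.
    move=> y; rewrite mem_cat => /orP[//|/fv_subst[[]|//]].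
    have [_ fvS _ _] := f_sentP D; by move/fvS; rewrite !inE => ->.
  rewrite gforces_sat sat_subst_numeral sat_Imp => u1 _.
  (* True in every structure, as all interpretations lie within [SENT L]. *)
  rewrite sat_Tr => un; apply/sat_Sent_Var; exact: interp_sent un.
- move=> B sB; rewrite sat_Imp => w1 _; rewrite sat_Tr eval_quote.
  by rewrite -gforces_sat; apply: interp_gforces.
Qed.
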